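(* In the EGARCH(1,1) model described in the context, let $\mathbf B_{ii}$, $1\le i\le4$, be the diagonal entries of the matrix $\mathbf B=\mathbb E[\nabla g_t(\theta_0)(\nabla g_t(\theta_0))^T]$ and let $V_0=\beta_0-2^{-1}(\gamma_0Z_0+\delta_0|Z_0|)$. Then $$\sum_{i=1}^4\mathbf B_{ii}<\infty\quad\text{if and only if}\quad\mathbb E[V_0^2]<1 .$$
   Context: EGARCH(1,1) model. $(Z_t)_{t\in\mathbb Z}$ is an iid sequence of real random variables, not concentrated on two points, with $\mathbb E[Z_0^2]=1$. $X_t=\sigma_tZ_t$ with $\log\sigma_t^2=\alpha_0+\beta_0\log\sigma_{t-1}^2+\gamma_0Z_{t-1}+\delta_0|Z_{t-1}|$, $|\beta_0|<1$, and $(\sigma_t^2)$ is the stationary solution $\log\sigma_t^2=\alpha_0(1-\beta_0)^{-1}+\sum_{k\ge1}\beta_0^{k-1}(\gamma_0Z_{t-k}+\delta_0|Z_{t-k}|)$. The true parameter $\theta_0=(\alpha_0,\beta_0,\gamma_0,\delta_0)$ satisfies $\beta_0\ge0$, $\delta_0\ge|\gamma_0|$ and the invertibility condition $$\mathbb E\left[\log\left(\max\left\{\beta_0,\ 2^{-1}(\gamma_0X_0+\delta_0|X_0|)\exp\left(-2^{-1}\alpha_0/(1-\beta_0)\right)-\beta_0\right\}\right)\right]<0 .$$ For $\theta=(\alpha,\beta,\gamma,\delta)$, $g_t(\theta)$ is the stationary solution of $g_t(\theta)=\alpha+\beta g_{t-1}(\theta)+(\gamma X_{t-1}+\delta|X_{t-1}|)\exp(-g_{t-1}(\theta)/2)$,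 $t\in\mathbb Z$. With $U_t=(1,\log\sigma_t^2,Z_t,|Z_t|)^T$ and $V_t=\beta_0-2^{-1}(\gamma_0Z_t+\delta_0|Z_t|)$, its gradient at $\theta_0$ is the stationary solution of the linear recursion $\nabla g_t(\theta_0)=U_{t-1}+V_{t-1}\nabla g_{t-1}(\theta_0)$, i.e. $\nabla g_t(\theta_0)=\sum_{l=1}^\infty U_{t-l}\prod_{k=1}^{l-1}V_{t-k}$ (empty product equal to $1$). Thus $$\mathbf B_{11}=\mathbb E\Big[\sum_{l\ge1}\prod_{k=1}^{l-1}V_{t-k}\Big]^2,\quad \mathbf B_{22}=\mathbb E\Big[\sum_{l\ge1}\log\sigma_{t-l}^2\prod_{k=1}^{l-1}V_{t-k}\Big]^2,$$ $$\mathbf B_{33}=\mathbb E\Big[\sum_{l\ge1}Z_{t-l}\prod_{k=1}^{l-1}V_{t-k}\Big]^2,\quad \mathbf B_{44}=\mathbb E\Big[\sum_{l\ge1}|Z_{t-l}|\prod_{k=1}^{l-1}V_{t-k}\Big]^2,$$ where $\mathbb E[\cdot]^2$ denotes the expectation of the square. *)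

(* Defs.v *)
(* World: MathComp-Analysis. *)
From HB Require Import structures.
From mathcomp Require Import all_boot all_order all_algebra.
From mathcomp Require Import all_classical all_reals all_analysis.
Import Order.TTheory GRing.Theory Num.Theory.
Import numFieldNormedType.Exports.

Set Implicit Arguments.
Unset Strict Implicit.
Unset Printing Implicit Defensive.

Local Open Scope classical_set_scope.
Local Open Scope ring_scope.

Section iid.
Context (d : measure_display) (T : measurableType d) (R : realType)
        (P : probability T R).

Definition mutually_independent (Z : int -> {RV P >-> R}) : Prop :=
  forall (s : seq int) (A : int -> set R), uniq s ->
    (forall t, measurable (A t)) ->
    P (\bigcap_(t in [set` s]) (Z t @^-1` A t)) =
    (\prod_(t <- s) P (Z t @^-1` A t))%E.

Definition identically_distributed (Z : int -> {RV P >-> R}) : Prop :=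
  forall (t : int) (A : set R), measurable A ->
    distribution P (Z t) A = distribution P (Z 0) A.

Definition iid (Z : int -> {RV P >-> R}) : Prop :=
  mutually_independent Z /\ identically_distributed Z.

Definition two_point (X : {RV P >-> R}) : Prop :=
  exists a b : R, P (X @^-1` [set a; b]) = 1%E.

End iid.

(* Infinite sums of reals are limits of partial sums taken pointwise in [w],
   and indexed from [n = 0], so that [n.+1] is the summation index of the
   formulas. [limn] takes the value 0 where the partial sums diverge; all the
   series below converge almost surely under the hypotheses on the model. *)
Section egarch.
Context (d : measure_display) (T : measurableType d) (R : realType)
        (P : probability T R).
Variables (Z : int -> {RV P >-> R}) (alpha beta gamma delta : R).

Definition log_sigma2 (t : int) (w : T) : R :=
  alpha * (1 - beta)^-1 +
  limn [series beta ^+ n * (gamma * Z (t - n.+1%:Z) w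
                            + delta * `|Z (t - n.+1%:Z) w|)]_n.

Definition sigma2 (t : int) (w : T) : R := expR (log_sigma2 t w).

Definition X_ (t : int) (w : T) : R := Num.sqrt (sigma2 t w) * Z t w.

(* [lne 0 = -oo], whereas the real logarithm of the library has [ln 0 = 0]; the
   argument does vanish with positive probability in some cases with
   [beta = 0]. The positive part of the logarithm is integrable as soon as
   [Z] has a second moment, so the integral is a well-defined element of
   [[-oo, +oo[] in the model. *)
Definition invertible : Prop :=
  (\int[P]_w lne (Num.max beta
      (2^-1 * (gamma * X_ 0 w + delta * `|X_ 0 w|)
            * expR (- (2^-1 * alpha / (1 - beta))) - beta))%R%:E < 0)%E.

Definition U_ (t : int) (w : T) : 'cV[R]_4 :=
  \col_(i < 4) [:: 1; log_sigma2 t w; Z t w; `|Z t w|]`_i.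

Definition V_ (t : int) (w : T) : R :=
  beta - 2^-1 * (gamma * Z t w + delta * `|Z t w|).

(* The gradient of [g_t] at the true parameter, as the stationary solution of
   [grad_g t = U_ (t - 1) + V_ (t - 1) * grad_g (t - 1)]. *)
Definition grad_g (t : int) (w : T) : 'cV[R]_4 :=
  \col_(i < 4) limn [series U_ (t - n.+1%:Z) w i 0
                            * \prod_(1 <= k < n.+1) V_ (t - k%:Z) w]_n.

(* Only the diagonal entries, which are integrals of squares, are guaranteed
   to be meaningful (with values in [[0, +oo]]) without further assumptions. *)
Definition B_ (t : int) : 'M[\bar R]_4 :=
  \matrix_(i < 4, j < 4) 'E_P[fun w => (grad_g t w *m (grad_g t w)^T) i j]%E.

End egarch.

(* Main.v *)
Require Import Defs.
From HB Require Import structures.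
From mathcomp Require Import all_boot all_order all_algebra.
From mathcomp Require Import all_classical all_reals all_analysis.
From mathcomp Require Import ring lra zify measurable_realfun.
Import Order.TTheory GRing.Theory Num.Theory.
Import numFieldNormedType.Exports.

Local Open Scope classical_set_scope.
Local Open Scope ring_scope.

Set Implicit Arguments.
Unset Strict Implicit.
Unset Printing Implicit Defensive.

(** Write [v x = beta - (gamma x + delta |x|) / 2], so that [V_t = v (Z_t)], and
    let [L] be the law of [Z_0]. Every entry of the gradient is an infinite sum
    of terms [U_(t-l) V_(t-1) ... V_(t-l+1)], where [U_(t-l)] depends only on
    [Z_(t-l), Z_(t-l-1), ...] and is therefore independent of the product.
    The whole argument takes place under the law [Q] of the past
    [(Z_(t-1), Z_(t-2), ...)] on the space of real sequences, and uses one
    property of [Q]: prepending an independent [L]-distributed coordinate to a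
    [Q]-distributed sequence gives again the law [Q]. This single identity
    encodes independence of the newest innovation from the older ones
    and stationarity ([ge0_integral_head_shift], [integral_head_shift]).

    If [e = E V_0^2 < 1], the second moment of the [n]-th term is at most
    [C e^n]. For [e < r < 1] the weighted Cauchy-Schwarz inequality
    [(sum u_n)^2 <= (1 - r)^-1 sum r^-n u_n^2] bounds the second moment of
    the sum by a convergent geometric series ([integral_perpetuity_lty]). The
    entry with [log sigma^2] needs [E (log sigma^2)^2 < oo], which the same
    inequality with weights [beta^n] provides.

    Conversely suppose that [B_11] is finite and let
    [G_t = sum_l V_(t-1) ... V_(t-l+1)].

    - The series converges almost surely. As the volatility [sigma_0] is at
      least its minimal value [exp (alpha / (2 (1 - beta)))], the
      invertibility condition gives [E log Y < 0] for
      [Y = max (beta, - V_0) >= |V_0|].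
      Since [n (y^(1/n) - 1)] tends to [log y], some fractional moment
      [E Y^(1/n)] is less than 1 ([exists_root_expectation_lt1]). So the
      [1/n]-th powers of the products have summable expectations, whence
      their sum, and with it the sum of the products themselves, is almost
      surely finite ([abs_sum_lty_ae]).

    - Hence [G_t = 1 + V_(t-1) G_(t-1)], where the two factors are independent
      and [G_(t-1)] has the law of [G_t]. With [mu = E G], [m = E G^2] and
      [a = E V <= beta < 1] this gives [mu (1 - a) = 1], so [mu <> 0], and
      [m = 1 + 2 a mu + e m]; eliminating,
      [(m - mu^2) (1 - e) = mu^2 (e - a^2)]. Both variances [m - mu^2] and
      [e - a^2] are nonnegative, so if [e >= 1] then [e = a^2], that is, [V_0]
      is almost surely the constant [a]. Its fractional moment being less than
      1, [|a| < 1], and [e = a^2 < 1] after all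
      ([second_moment_lt1_of_perpetuity]). *)

(** * Real series *)

Lemma weighted_cauchy_schwarz (R : realFieldType) (a x : nat -> R) (n : nat) :
  (forall i, 0 <= a i) ->
  (\sum_(0 <= i < n) a i * x i) ^+ 2 <=
  (\sum_(0 <= i < n) a i) * \sum_(0 <= i < n) a i * x i ^+ 2.
Proof.
move=> a0; elim: n => [|n IHn]; first by rewrite !big_nil expr0n mulr0.
rewrite !big_nat_recr//=.
have A0 : 0 <= \sum_(0 <= i < n) a i by apply: sumr_ge0.
have Q0 : 0 <= \sum_(0 <= i < n) a i * x i ^+ 2.
  by apply: sumr_ge0 => i _; rewrite mulr_ge0// sqr_ge0.
move: (\sum_(0 <= i < n) a i) (\sum_(0 <= i < n) a i * x i ^+ 2)
      (\sum_(0 <= i < n) a i * x i) (a n) (a0 n) (x n) A0 Q0 IHn.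
move=> A Q S b b0 y A0 Q0 SAQ.
have cross : 2 * (S * y) <= A * y ^+ 2 + Q.
  have [A0'|Ap] := eqVneq A 0.
    have S0 : S = 0.
      by apply/eqP; rewrite -sqrf_eq0 eq_le sqr_ge0 andbT (le_trans SAQ)// A0' mul0r.
    by rewrite S0 A0' !mul0r mulr0 add0r.
  have Agt : 0 < A by rewrite lt0r Ap.
  rewrite -subr_ge0 -(pmulr_rge0 _ Agt).
  have -> : A * (A * y ^+ 2 + Q - 2 * (S * y)) = (A * y - S) ^+ 2 + (A * Q - S ^+ 2) by ring.
  by rewrite addr_ge0// ?sqr_ge0// subr_ge0.
have : 0 <= b * (A * y ^+ 2 + Q - 2 * (S * y)) by rewrite mulr_ge0// subr_ge0.
nra.
Qed.

(** Passage to the limit in the finite inequality; where the series diverges, the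
    limit operator returns 0 and the left-hand side vanishes. *)
Lemma sqr_limn_series_le (R : realType) (a x : nat -> R) (A : R) :
  (forall i, 0 <= a i) -> (forall n, \sum_(0 <= i < n) a i <= A) ->
  ((limn [series a n * x n]_n ^+ 2)%:E <=
   A%:E * \sum_(n <oo) (a n * x n ^+ 2)%:E)%E.
Proof.
move=> a0 aA.
have A0 : 0 <= A by apply: le_trans (aA 0%N); rewrite big_nil.
have t0 n : (0 <= (a n * x n ^+ 2)%:E)%E by rewrite lee_fin mulr_ge0// sqr_ge0.
have [cs|/dvgP ->] := pselect (cvgn [series a n * x n]_n); last first.
  by rewrite expr0n; apply: mule_ge0; [rewrite lee_fin|apply: nneseries_ge0].
have csq : ([series a n * x n]_n k ^+ 2 @[k --> \oo] -->
    limn [series a n * x n]_n ^+ 2).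
  by apply: cvgM.
rewrite -(cvg_lim _ csq)// -EFin_lim; last by apply/cvg_ex; eexists; exact: csq.
apply: lime_le.
  by apply/cvg_ex; eexists; apply: cvg_EFin; [exact: nearW|exact: csq].
near=> k => /=.
have partial : (A%:E * (\sum_(0 <= i < k) (a i * x i ^+ 2)%:E) <=
    A%:E * \sum_(n <oo) (a n * x n ^+ 2)%:E)%E.
  by rewrite lee_wpmul2l ?lee_fin// nneseries_lim_ge.
apply: le_trans partial.
rewrite sumEFin -EFinM lee_fin /series/=.
apply: (le_trans (weighted_cauchy_schwarz _ _ a0)).
by rewrite ler_wpM2r// sumr_ge0// => i _; rewrite mulr_ge0// sqr_ge0.
Unshelve. all: by end_near. Qed.

Lemma nneseries_lty_cvg_series (R : realType) (u : nat -> R) :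
  (\sum_(n <oo) (`|u n|%R)%:E < +oo)%E -> cvgn (series u).
Proof.
move=> h; apply: (@normed_cvg R R^o).
by apply: (nnseries_is_cvg _ h) => i; exact: normr_ge0.
Qed.

(** A summable nonnegative sequence is bounded by its sum [B], and then
    [b_n ^ (m + 1) <= B ^ m b_n]. *)
Lemma nneseries_exprS_lty (R : realType) (b : nat -> R) (m : nat) :
  (forall n, 0 <= b n) -> (\sum_(n <oo) (b n)%:E < +oo)%E ->
  (\sum_(n <oo) (b n ^+ m.+1)%:E < +oo)%E.
Proof.
move=> b0 bfin.
have t0 n : (0 <= (b n)%:E)%E by rewrite lee_fin.
have Bfin : (\sum_(n <oo) (b n)%:E)%E \is a fin_num.
  by rewrite ge0_fin_numE// nneseries_ge0.
set B := fine (\sum_(n <oo) (b n)%:E)%E.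
have bB n : b n <= B.
  rewrite -lee_fin /B fineK//.
  apply: (@le_trans _ _ (\sum_(0 <= i < n.+1) (b i)%:E)%E); last exact: nneseries_lim_ge.
  by rewrite big_nat_recr//= leeDr// sume_ge0.
have B0 : 0 <= B := le_trans (b0 0%N) (bB 0%N).
apply: (@le_lt_trans _ _ ((B ^+ m)%:E * \sum_(n <oo) (b n)%:E)%E).
  rewrite -nneseriesZl//; apply: lee_nneseries => n.
    by move=> _ _; rewrite lee_fin exprn_ge0.
  by move=> _; rewrite -EFinM lee_fin exprSr ler_wpM2r// lerXn2r// nnegrE.
by rewrite -(fineK Bfin) -EFinM ltry.
Qed.

Lemma limn_series_ge0 (R : realType) (u : nat -> R) :
  (forall n, 0 <= u n) -> 0 <= limn (series u).
Proof.
move=> u0; have [cu|/dvgP ->//] := pselect (cvgn (series u)).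
by apply: limr_ge => //; apply: nearW => n; exact: sumr_ge0.
Qed.

Lemma geometric_sum_le (R : realFieldType) (r : R) (n : nat) :
  0 <= r -> r < 1 -> \sum_(0 <= i < n) r ^+ i <= (1 - r)^-1.
Proof.
move=> r0 r1; have r1' : 0 < 1 - r by rewrite subr_gt0.
rewrite -[leRHS]mul1r ler_pdivlMr//.
have -> : (\sum_(0 <= i < n) r ^+ i) * (1 - r) = 1 - r ^+ n.
  elim: n => [|n IHn]; first by rewrite big_nil mul0r expr0 subrr.
  by rewrite big_nat_recr//= mulrDl IHn exprS; ring.
by rewrite gerBl exprn_ge0.
Qed.

Lemma nneseries_geometric_lty (R : realType) (r : R) :
  0 <= r -> r < 1 -> (\sum_(n <oo) (r ^+ n)%:E < +oo)%E.
Proof.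
move=> r0 r1; apply: (@le_lt_trans _ _ ((1 - r)^-1)%:E); last exact: ltry.
apply: lime_le.
  by apply: is_cvg_nneseries => n _ _; rewrite lee_fin exprn_ge0.
by apply: nearW => n; rewrite sumEFin lee_fin geometric_sum_le.
Qed.

(** * Integrals *)

(** The integral is a difference of two suprema over simple functions, each
    monotone in the integrand. The integrands to compare include limits of series
    that may diverge, for which measurability is not at hand. *)
Lemma le_integral_pointwise d (T : measurableType d) (R : realType)
    (mu : {measure set T -> \bar R}) (f g : T -> \bar R) :
  (forall x, f x <= g x)%E -> (\int[mu]_x f x <= \int[mu]_x g x)%E.
Proof.
move=> fg.
have mono (u v : T -> \bar R) : (forall x, 0 <= u x)%E -> (forall x, u x <= v x)%E ->
    (\int[mu]_x u x <= \int[mu]_x v x)%E.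
  move=> u0 uv; have v0 x : (0 <= v x)%E by apply: le_trans (uv x).
  rewrite !ge0_integralTE//; apply: le_ereal_sup => _ [h hu <-].
  by exists h => // x; apply: le_trans (uv x); exact: hu.
rewrite integralE [leRHS]integralE; apply: leeB; apply: mono => // x.
  by apply: funepos_le => //; rewrite inE.
by apply: funeneg_le => //; rewrite inE.
Qed.

Lemma integral_cst_probability d (T : measurableType d) (R : realType)
  (P : probability T R) (a : R) : (\int[P]_x a%:E = a%:E)%E.
Proof.
have := integral_cst P measurableT a%:E; rewrite /cst => ->.
by rewrite [X in (_ * X)%E](@probability_setT _ _ _ P) mule1.
Qed.

Lemma integrable_cst_probability d (T : measurableType d) (R : realType)
  (P : probability T R) (a : R) : P.-integrable setT (fun=> a%:E).
Proof. exact: (finite_measure_integrable_cst P a measurableT). Qed.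

Lemma integral_quadratic d (T : measurableType d) (R : realType)
    (P : probability T R) (f : T -> R) (a b c m1 m2 : R) :
  P.-integrable setT (fun x => (f x)%:E) ->
  P.-integrable setT (fun x => (f x ^+ 2)%:E) ->
  (\int[P]_x (f x)%:E = m1%:E)%E -> (\int[P]_x (f x ^+ 2)%:E = m2%:E)%E ->
  (\int[P]_x (a + b * f x + c * f x ^+ 2)%:E = (a + b * m1 + c * m2)%:E)%E.
Proof.
move=> if1 if2 e1 e2.
have ib : P.-integrable setT (fun x => (b%:E * (f x)%:E)%E) by exact: integrableZl.
have ic : P.-integrable setT (fun x => (c%:E * (f x ^+ 2)%:E)%E) by exact: integrableZl.
have ia := integrable_cst_probability P a.
transitivity (\int[P]_x (a%:E + b%:E * (f x)%:E + c%:E * (f x ^+ 2)%:E))%E.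
  by apply: eq_integral => x _; rewrite -!EFinM -!EFinD.
rewrite integralD//; last exact: integrableD.
by rewrite integralD// !integralZl// e1 e2 integral_cst_probability -!EFinM -!EFinD.
Qed.

Lemma measurable_quadratic d (T : measurableType d) (R : realType) (f : T -> R) (a b c : R) :
  measurable_fun setT f -> measurable_fun setT (fun x => (a + b * f x + c * f x ^+ 2)%:E).
Proof.
move=> mf; apply/measurable_EFinP; apply: measurable_funD; first apply: measurable_funD => //.
  exact: measurable_funM.
by apply: measurable_funM => //; exact: measurable_funX.
Qed.

Lemma integrable_sqr d (T : measurableType d) (R : realType)
    (P : probability T R) (f : T -> R) : measurable_fun setT f ->
  (\int[P]_x (f x ^+ 2)%:E < +oo)%E ->
  P.-integrable setT (fun x => (f x)%:E) /\ P.-integrable setT (fun x => (f x ^+ 2)%:E).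
Proof.
move=> mf f2.
have i2 : P.-integrable setT (fun x => (f x ^+ 2)%:E).
  apply/integrableP; split; first exact/measurable_EFinP/measurable_funX.
  by under eq_integral do rewrite gee0_abs ?lee_fin ?sqr_ge0//.
split=> //.
have := integrableD measurableT (integrable_cst_probability P 1) i2.
apply: le_integrable => //; first exact/measurable_EFinP.
move=> x _; rewrite /= lee_fin.
rewrite (ger0_norm (_ : 0 <= 1 + f x ^+ 2)); last by rewrite addr_ge0// sqr_ge0.
rewrite -[f x ^+ 2]ger0_norm ?sqr_ge0// normrX; have := normr_ge0 (f x).
move: (`|f x|) => y; nra.
Qed.

(** * Fractional moments of a variable with negative mean logarithm *)

Lemma bernoulli_ineq (R : realDomainType) (u : R) (k : nat) :
  0 <= u -> k%:R * (u - 1) <= u ^+ k - 1.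
Proof.
move=> u0; elim: k => [|k IHk]; first by rewrite mul0r expr0 subrr.
have : u * (k%:R * (u - 1)) <= u * (u ^+ k - 1) by rewrite ler_wpM2l.
have : 0 <= k%:R * (u - 1) ^+ 2 by rewrite mulr_ge0// sqr_ge0.
rewrite (exprS u k) -natr1; move: (u ^+ k) (k%:R : R) => a b; nra.
Qed.

Lemma root_powR_le (R : realType) (y : R) (k : nat) :
  0 <= y -> k.+1%:R * (y `^ k.+1%:R^-1 - 1) <= y - 1.
Proof.
move=> y0; apply: (le_trans (bernoulli_ineq k.+1 (powR_ge0 _ _))).
by rewrite -powR_mulrn ?powR_ge0// -powRrM mulVf ?pnatr_eq0// powRr1.
Qed.

(** With [x = ln y] and [k = n + 1], the inequality [1 + u <= expR u] at
    [u = x / k] and at [- x / k] squeezes the sequence between [x] and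
    [x * expR (x / k)]. *)
Lemma cvg_root_powR_ln (R : realType) (y : R) : 0 < y ->
  n.+1%:R * (y `^ n.+1%:R^-1 - 1) @[n --> \oo] --> ln y.
Proof.
move=> y0; set x := ln y.
have yE n : y `^ n.+1%:R^-1 = expR (x / n.+1%:R).
  by rewrite /powR gt_eqF// mulrC.
apply: (@squeeze_cvgr _ _ _ _ (fun=> x) (fun n => x * expR (x / n.+1%:R))).
- apply: nearW => n; rewrite yE.
  have k0 : 0 < n.+1%:R :> R by rewrite ltr0n.
  have xE : x = n.+1%:R * (x / n.+1%:R) by rewrite mulrC divfK// gt_eqF.
  move: (x / n.+1%:R) xE => u ->; apply/andP; split.
    by rewrite ler_pM2l// lerBrDr addrC expR_ge1Dx.
  rewrite -mulrA ler_pM2l//.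
  have := expR_ge1Dx (- u); have := expR_gt0 u; have := expRxMexpNx_1 u.
  move: (expR u) (expR (- u)) => a b; nra.
- exact: cvg_cst.
- rewrite -[X in _ --> X]mulr1; apply: cvgM; first exact: cvg_cst.
  rewrite -[X in _ --> X]expR0; apply: continuous_cvg; first exact: continuous_expR.
  rewrite -[X in _ --> X](mulr0 x); apply: cvgM; first exact: cvg_cst.
  exact: cvg_harmonic.
Qed.

(** If every root had expectation at least 1, Fatou's lemma applied to
    [Y - 1 - k (Y ^ (1 / k) - 1)], which is nonnegative by Bernoulli's inequality
    and tends to [Y - 1 - log Y], would give [E (Y - 1 - log Y) <= E (Y - 1)],
    that is, [E log Y >= 0]. *)
Lemma exists_root_expectation_lt1 d (T : measurableType d) (R : realType)
    (P : probability T R) (Y : T -> R) :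
  measurable_fun [set: T] Y -> (forall w, 0 <= Y w) ->
  P.-integrable [set: T] (EFin \o Y) ->
  (\int[P]_w lne (Y w)%:E < 0)%E ->
  exists m : nat, (\int[P]_w (Y w `^ m.+1%:R^-1)%:E < 1)%E.
Proof.
move=> mY Y0 iY neg; apply: contrapT => /forallNP all1.
have {}all1 m : (1 <= \int[P]_w (Y w `^ m.+1%:R^-1)%:E)%E.
  by rewrite leNgt; apply/negP; exact: all1.
pose f n w := Y w - 1 - n.+1%:R * (Y w `^ n.+1%:R^-1 - 1).
have f0 n w : 0 <= f n w by rewrite subr_ge0 root_powR_le.
have mroot n : measurable_fun setT (fun w => Y w `^ n.+1%:R^-1).
  by apply: (measurableT_comp (measurable_powR _) mY).
have mf n : measurable_fun setT (f n).
  apply: measurable_funB; first exact: measurable_funB.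
  by apply: measurable_funM => //; exact: measurable_funB.
have i1 := integrable_cst_probability P 1.
have iY1 : P.-integrable setT (fun w => (Y w - 1)%:E).
  have := integrableB measurableT iY i1.
  by apply: eq_integrable => // w _ /=; rewrite EFinB.
have iroot n : P.-integrable setT (fun w => (Y w `^ n.+1%:R^-1)%:E).
  have := integrableD measurableT iY i1; apply: le_integrable => //.
    exact/measurable_EFinP.
  move=> w _ /=; rewrite lee_fin.
  rewrite !ger0_norm ?powR_ge0 ?addr_ge0 ?Y0//.
  have := root_powR_le n (Y0 w); have : 1 <= n.+1%:R :> R by rewrite ler1n.
  have := powR_ge0 (Y w) n.+1%:R^-1; have := Y0 w.
  move: (Y w `^ n.+1%:R^-1) (Y w) (n.+1%:R : R) => a b c b0 a0 c1; case: (leP a 1) => *; nra.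
have intf n : (\int[P]_w (f n w)%:E <= \int[P]_w (Y w - 1)%:E)%E.
  rewrite /f; under eq_integral do rewrite EFinB.
  have iroot1 : P.-integrable setT (fun w => (Y w `^ n.+1%:R^-1 - 1)%:E).
    have := integrableB measurableT (iroot n) i1.
    by apply: eq_integrable => // w _ /=; rewrite EFinB.
  rewrite integralB_EFin//; last first.
    have := integrableZl measurableT n.+1%:R iroot1.
    by apply: eq_integrable => // w _ /=; rewrite EFinM.
  apply: geeDl; rewrite oppe_le0.
  under eq_integral do rewrite EFinM.
  rewrite integralZl// mule_ge0 ?lee_fin//.
  rewrite (_ : \int[P]_x _ = \int[P]_x ((Y x `^ n.+1%:R^-1)%:E - 1%:E))%E; last first.
    by apply: eq_integral => w _; rewrite EFinB.
  rewrite integralB_EFin//; last exact: iroot.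
  by rewrite sube_ge0 integral_cst_probability ?all1.
pose H w := ((Y w - 1)%:E - lne (Y w)%:E)%E.
have cvg_f w : (f n w)%:E @[n --> \oo] --> H w.
  have [Yw0|Ywn0] := eqVneq (Y w) 0.
    rewrite /H Yw0 le0_lneNy//=.
    apply/cvgeyPge => A; near=> n.
    rewrite /f Yw0 powR0 ?invr_neq0 ?pnatr_eq0// sub0r mulrN1 opprK -natr1 addrC addrK lee_fin.
    by near: n; exact: nbhs_infty_ger.
  have Ywp : 0 < Y w by rewrite lt_neqAle eq_sym Ywn0 Y0.
  rewrite /H lne_EFin// -EFinB.
  apply: cvg_EFin; first exact: nearW.
  by apply: cvgB; [exact: cvg_cst|exact: cvg_root_powR_ln].
have mH : measurable_fun setT H.
  by apply: (emeasurable_fun_cvg (fun n w => (f n w)%:E)) => // n; exact/measurable_EFinP.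
have H0 w : (0 <= H w)%E.
  rewrite sube_ge0; last by rewrite orbC.
  have := @le_lne1Dx _ (Y w - 1)%:E; rewrite -EFinD (addrC 1%R) subrK; apply.
  by rewrite lee_fin lerBrDr addNr Y0.
have Hle : (\int[P]_w H w <= \int[P]_w (Y w - 1)%:E)%E.
  have -> : H = (fun w => limn_einf (fun n => (f n w)%:E)).
    by apply/funext => w; rewrite (fst (cvg_limn_einf_sup (cvg_f w))).
  have fat := @fatou _ _ _ P _ measurableT (fun n w => (f n w)%:E)
   (fun n => (measurable_EFinP _ _).2 (mf n)) (fun n w _ => f0 n w).
  apply: (le_trans fat); rewrite limn_einf_lim.
  apply: lime_le; first exact: is_cvg_einfs.
  apply: nearW => n; apply: (le_trans _ (intf n)).
  by apply: ereal_inf_lbound; exists n => //=.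
have iH : P.-integrable setT H.
  apply/integrableP; split=> //.
  under eq_integral do rewrite gee0_abs//.
  apply: (le_lt_trans Hle (integrable_lty _ iY1)); exact: measurableT.
have subeKl (a : R) (x : \bar R) : x = (a%:E - (a%:E - x))%E.
  by case: x => [r| |] //; rewrite -!EFinB opprB addrC subrK.
have lneE w : lne (Y w)%:E = ((Y w - 1)%:E - H w)%E := subeKl _ _.
have intE : (\int[P]_w lne (Y w)%:E = \int[P]_w (Y w - 1)%:E - \int[P]_w H w)%E.
  by rewrite -integralB//; apply: eq_integral => w _; rewrite lneE.
have fin1 : (\int[P]_w (Y w - 1)%:E)%E \is a fin_num by exact: integrable_fin_num.
move: neg; rewrite intE ltNge sube_ge0; first by rewrite Hle.
by rewrite fin1 orbT.
Unshelve. all: by end_near. Qed.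

(** * The law of an iid sequence *)

Section sequence_space.
Variable R : realType.

Definition cylinder (A : nat -> set R) : set (nat -> R) :=
  [set z | forall n, A n (z n)].

(** Only finitely many coordinates of a cylinder are constrained, so that its
    probability is a finite product. *)
Definition cylinders : set (set (nat -> R)) :=
  [set C | exists A N, [/\ forall n, measurable (A n),
     forall n, (N <= n)%N -> A n = setT & C = cylinder A]].

Definition seqspace := g_sigma_algebraType cylinders.

Lemma cylindersI : setI_closed cylinders.
Proof.
move=> _ _ [A [N [mA AN ->]]] [B [M [mB BM ->]]].
exists (fun n => A n `&` B n), (maxn N M); split.
- by move=> n; exact: measurableI.
- by move=> n; rewrite geq_max => /andP[Nn Mn]; rewrite AN// BM// setTI.
- apply/seteqP; split => z; first by move=> [Az Bz] n; split.
  by move=> ABz; split => n; case: (ABz n).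
Qed.

Lemma cylindersT : cylinders [set: nat -> R].
Proof.
exists (fun=> setT), 0%N; split=> //.
by apply/seteqP; split.
Qed.

Lemma measurable_coord (n : nat) : measurable_fun setT (fun z : seqspace => z n).
Proof.
move=> _ A mA; rewrite setTI; apply: sub_sigma_algebra.
exists (fun k => if k == n then A else setT), n.+1; split.
- by move=> k; case: ifP.
- by move=> k nk; case: eqP => // kn; move: nk; rewrite kn ltnn.
- apply/seteqP; split => z /=.
    by move=> Az k; case: eqP => // ->.
  by move=> /(_ n); rewrite eqxx.
Qed.

Lemma measurable_to_seqspace d (T : measurableType d) (f : T -> seqspace) :
  (forall n, measurable_fun setT (fun w => f w n)) -> measurable_fun setT f.
Proof.
move=> mf; apply: (@measurability _ _ T seqspace setT f cylinders) => //.
move=> _ [_ [A [N [mA AN ->]]] <-]; rewrite setTI.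
have -> : f @^-1` cylinder A = \bigcap_n ((fun w => f w n) @^-1` A n).
  by apply/seteqP; split => w /=; [move=> h n _; exact: h|move=> h n; exact: h].
by apply: bigcapT_measurable => n; rewrite -[X in measurable X]setTI; exact: mf.
Qed.

Definition iid_law (L : probability R R) (Q : set seqspace -> \bar R) :=
  forall A N, (forall n, measurable (A n)) ->
    (forall n, (N <= n)%N -> A n = setT) ->
    Q (cylinder A) = (\prod_(0 <= n < N) L (A n))%E.

(** Cylinders form a pi-system that generates the sigma-algebra. *)
Lemma iid_law_unique (L : probability R R) (Q1 Q2 : probability seqspace R) :
  iid_law L Q1 -> iid_law L Q2 ->
  forall B, measurable B -> Q1 B = Q2 B.
Proof.
move=> l1 l2 B mB.
apply: (@measure_unique _ R seqspace cylinders (fun=> setT) _ _ _ _ Q1 Q2 _ _ B mB) => //.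
- exact: cylindersI.
- by move=> _; exact: cylindersT.
- by rewrite bigcup_const.
- move=> _ [A [N [mA AN ->]]]; exact: (etrans (l1 A N mA AN) (esym (l2 A N mA AN))).
- by move=> _; rewrite -ge0_fin_numE// fin_num_measure.
Qed.

Definition cons_seq (p : R * seqspace) : seqspace :=
  fun n => if n is k.+1 then p.2 k else p.1.

Lemma measurable_cons_seq : measurable_fun setT cons_seq.
Proof.
apply: measurable_to_seqspace => -[|n] /=.
  exact: measurable_fst.
exact: (measurableT_comp (measurable_coord n) measurable_snd).
Qed.

HB.instance Definition _ :=
  isMeasurableFun.Build _ _ _ _ cons_seq measurable_cons_seq.

Definition shift_seq (z : seqspace) : seqspace := fun n => z n.+1.

Lemma measurable_shift_seq : measurable_fun setT shift_seq.
Proof. by apply: measurable_to_seqspace => n; exact: measurable_coord. Qed.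

Section law.
Variables (L : probability R R) (Q : probability seqspace R).
Hypothesis LQ : iid_law L Q.

(** Prepending an independent coordinate to an iid sequence gives an iid
    sequence: the law [Q] is a fixed point of [cons_seq]. *)
Lemma iid_law_cons : iid_law L (distribution (L \x Q)%E cons_seq).
Proof.
move=> A N mA AN.
rewrite /distribution /pushforward.
have -> : cons_seq @^-1` cylinder A = A 0%N `*` cylinder (fun n => A n.+1).
  apply/seteqP; split => -[x z] /=.
    by move=> h; split=> [|n]; [exact: (h 0%N)|exact: (h n.+1)].
  by move=> [A0 AS] [|n]; [exact: A0|exact: AS].
have mcyl : measurable (cylinder (fun n => A n.+1) : set seqspace).
  apply: sub_sigma_algebra; exists (fun n => A n.+1), N; split => //.
  by move=> n Nn; apply: AN; exact: leqW.
apply: (etrans (product_measure1E _ _ _ _)) => //.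
case: N AN => [|N] AN.
  rewrite big_geq// (AN 0%N)// [X in (X * _)%E](@probability_setT _ _ _ L) mul1e.
  have := @LQ (fun n => A n.+1) 0%N (fun n => mA n.+1).
  by rewrite big_geq//; apply => n _; exact: AN.
have QE := @LQ (fun n => A n.+1) N (fun n => mA n.+1) (fun n Nn => AN n.+1 Nn).
by rewrite [X in (_ * X)%E]QE big_nat_recl.
Qed.


Lemma integral_iid_law_cons (F : seqspace -> \bar R) :
  (\int[Q]_z F z = \int[distribution (L \x Q)%E cons_seq]_z F z)%E.
Proof.
by apply: eq_measure_integral => A mA _; exact: (iid_law_unique LQ iid_law_cons).
Qed.

(** The head of the sequence is independent of its tail, and the tail is
    distributed as the sequence itself. *)
Lemma ge0_integral_head_shift (phi : R -> \bar R) (h : seqspace -> \bar R) :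
  measurable_fun setT phi -> (forall x, 0 <= phi x)%E ->
  measurable_fun setT h -> (forall z, 0 <= h z)%E ->
  (\int[Q]_z (phi (z 0%N) * h (shift_seq z)) =
   \int[L]_x phi x * \int[Q]_z h z)%E.
Proof.
move=> mphi phi0 mh h0.
have mF : measurable_fun setT (fun z : seqspace => phi (z 0%N) * h (shift_seq z))%E.
  apply: emeasurable_funM.
    exact: (measurableT_comp mphi (measurable_coord 0%N)).
  exact: (measurableT_comp mh measurable_shift_seq).
rewrite integral_iid_law_cons ge0_integral_distribution//; last first.
  by move=> z; rewrite mule_ge0.
rewrite fubini_tonelli1//; last 2 first.
- exact: (measurableT_comp mF measurable_cons_seq).
- by move=> p; rewrite mule_ge0.
rewrite /fubini_F/=.
under eq_integral => x _ do rewrite ge0_integralZl//.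
transitivity (\int[L]_x (phi x * \int[Q]_z h z))%E; first by [].
by rewrite (ge0_integralZr L measurableT mphi)//; exact: integral_ge0.
Qed.

Lemma integral_head_shift (phi : R -> R) (h : seqspace -> R) :
  L.-integrable setT (EFin \o phi) -> Q.-integrable setT (EFin \o h) ->
  (\int[Q]_z (phi (z 0%N) * h (shift_seq z))%:E =
   \int[L]_x (phi x)%:E * \int[Q]_z (h z)%:E)%E.
Proof.
move=> iphi ih.
have mphi : measurable_fun setT phi by apply/measurable_EFinP; exact: measurable_int iphi.
have mh : measurable_fun setT h by apply/measurable_EFinP; exact: measurable_int ih.
have mF : measurable_fun setT (fun z : seqspace => (phi (z 0%N) * h (shift_seq z))%:E).
  apply/measurable_EFinP/measurable_funM.
    exact: (measurableT_comp mphi (measurable_coord 0%N)).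
  exact: (measurableT_comp mh measurable_shift_seq).
have iF : (L \x Q)%E.-integrable setT
    ((fun z : seqspace => (phi (z 0%N) * h (shift_seq z))%:E) \o cons_seq).
  apply/integrable12ltyP; first exact: (measurableT_comp mF measurable_cons_seq).
  have mabs_phi : measurable_fun setT (fun x => `|(phi x)%:E|%E).
    by apply: measurableT_comp => //; exact/measurable_EFinP.
  have mabs_h : measurable_fun setT (fun z => `|(h z)%:E|%E).
    by apply: measurableT_comp => //; exact/measurable_EFinP.
  rewrite [ltLHS](_ : _ = \int[L]_x (`|(phi x)%:E| * \int[Q]_z `|(h z)%:E|))%E; last first.
    apply: eq_integral => x _; rewrite -ge0_integralZl//.
    by apply: eq_integral => z _; rewrite -abseM.
  rewrite (ge0_integralZr L measurableT)//; last exact: integral_ge0.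
  move/integrableP : iphi => [_ Lphi]; move/integrableP : ih => [_ Qh].
  have Lfin : (\int[L]_x `|(phi x)%:E|)%E \is a fin_num.
    by rewrite ge0_fin_numE// integral_ge0.
  have Qfin : (\int[Q]_x `|(h x)%:E|)%E \is a fin_num.
    by rewrite ge0_fin_numE// integral_ge0.
  by rewrite -(fineK Lfin) -(fineK Qfin) -EFinM ltry.
rewrite integral_iid_law_cons integral_distribution//.
rewrite -integral12_prod_meas1// /fubini_F/=.
rewrite -(fineK (integrable_fin_num measurableT ih)).
transitivity (\int[L]_x ((phi x)%:E * (fine (\int[Q]_z (h z)%:E))%:E))%E.
  apply: eq_integral => x _; rewrite fineK; last exact: (integrable_fin_num measurableT ih).
  by rewrite -(integralZl measurableT ih).
exact: (integralZr measurableT iphi).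
Qed.


End law.

Section path.
Context d (T : measurableType d) (P : probability T R) (Z : int -> {RV P >-> R}).

Definition past (t : int) (w : T) : seqspace := fun n => Z (t - n.+1%:Z) w.

Lemma measurable_past t : measurable_fun setT (past t).
Proof. by apply: measurable_to_seqspace => n; exact: measurable_funPT. Qed.

HB.instance Definition _ t :=
  isMeasurableFun.Build _ _ _ _ (past t) (measurable_past t).

Lemma iid_law_past t : iid Z -> iid_law (distribution P (Z 0)) (distribution P (past t)).
Proof.
move=> [indep ident] A N mA AN.
(* [B] re-indexes the constraints by time, inverting [n |-> t - (n + 1)] *)
pose B (s : int) := A (absz (t - 1 - s)%R).
have idx (n : nat) : absz (t - 1 - (t - n.+1%:Z))%R = n by lia.
have := indep [seq t - n.+1%:Z | n <- iota 0 N] B.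
rewrite big_map map_inj_uniq ?iota_uniq; last first.
  by move=> i j /addrI /oppr_inj [].
move=> /(_ isT (fun s => mA _)).
rewrite /index_iota subn0.
under [in RHS]eq_bigr => n _.
  rewrite /B idx.
  have := ident (t - n.+1%:Z) (A n) (mA n). rewrite /distribution /pushforward => ->.
  over.
move=> <-; rewrite /distribution /pushforward; congr (P _).
apply/seteqP; split => w /= h.
  move=> s /= /mapP[n nN ->]; rewrite /preimage /= /B idx; exact: h.
move=> n; have [Nn|nN] := leqP N n; first by rewrite AN.
have := h (t - n.+1%:Z); rewrite /= /preimage /= /B idx; apply.
by apply/mapP; exists n => //; rewrite mem_iota.
Qed.

End path.
End sequence_space.

Section products.
Variables (R : realType) (L : probability R R) (Q : probability (seqspace R) R).
Hypothesis LQ : iid_law L Q.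

Definition drop_seq (n : nat) (z : seqspace R) : seqspace R := fun k => z (n + k)%N.

Lemma measurable_drop_seq n : measurable_fun setT (drop_seq n).
Proof. by apply: measurable_to_seqspace => k; exact: measurable_coord. Qed.

Lemma measurable_prod_coord (phi : R -> R) n : measurable_fun setT phi ->
  measurable_fun setT (fun z : seqspace R => \prod_(0 <= k < n) phi (z k)).
Proof.
move=> mphi; apply: measurable_prod => k _.
exact: (measurableT_comp mphi (measurable_coord k)).
Qed.

(** Peeling off the [n] first coordinates one at a time: the tail
    [drop_seq n z] is again [Q]-distributed and independent of them. *)
Lemma integral_prod_drop (phi : R -> R) (e : R) (h : seqspace R -> \bar R) (n : nat) :
  measurable_fun setT phi -> (forall x, 0 <= phi x) ->
  (\int[L]_x (phi x)%:E = e%:E)%E ->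
  measurable_fun setT h -> (forall z, 0 <= h z)%E ->
  (\int[Q]_z ((\prod_(0 <= k < n) phi (z k))%:E * h (drop_seq n z)) =
   (e ^+ n)%:E * \int[Q]_z h z)%E.
Proof.
move=> mphi phi0 phie mh h0; elim: n => [|n IHn].
  by rewrite expr0 mul1e; apply: eq_integral => z _; rewrite big_geq// mul1e.
rewrite exprS EFinM -muleA -IHn -phie.
rewrite -(ge0_integral_head_shift LQ (phi := fun x => (phi x)%:E)
   (h := fun z => (\prod_(0 <= k < n) phi (z k))%:E * h (drop_seq n z))%E).
- by apply: eq_integral => z _; rewrite big_nat_recl// EFinM muleA.
- exact/measurable_EFinP.
- by move=> x; rewrite lee_fin.
- apply: emeasurable_funM; first by apply/measurable_EFinP; exact: measurable_prod_coord.
  exact: (measurableT_comp mh (measurable_drop_seq n)).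
- by move=> z; rewrite mule_ge0// lee_fin prodr_ge0.
Qed.

Lemma integral_coord (phi : R -> \bar R) (n : nat) :
  measurable_fun setT phi -> (forall x, 0 <= phi x)%E ->
  (\int[Q]_z phi (z n) = \int[L]_x phi x)%E.
Proof.
move=> mphi phi0.
have H := @integral_prod_drop (cst 1) 1 (fun z => phi (z 0%N)) n.
transitivity (\int[Q]_z ((\prod_(0 <= k < n) cst 1 (z k))%:E * phi (drop_seq n z 0%N)))%E.
  by apply: eq_integral => z _; rewrite big1// mul1e /drop_seq addn0.
rewrite H//; last 2 first.
- exact: integral_cst_probability.
- exact: (measurableT_comp mphi (measurable_coord 0%N)).
rewrite expr1n mul1e.
have := ge0_integral_head_shift LQ mphi phi0 (h := fun=> 1%E).
rewrite integral_cst_probability mule1 => <-//.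
by apply: eq_integral => z _; rewrite mule1.
Qed.

End products.

(** * Square integrability when the second moment is below one *)

Section sufficiency.
Variables (R : realType) (L : probability R R).
Variables (d : measure_display) (T : measurableType d) (P : probability T R).
Variable p : {mfun T >-> seqspace R}.
Local Notation Q := (distribution P p).
Hypothesis LQ : iid_law L Q.

(** The [n]-th term has second moment at most [e ^ n * E h]. The weighted
    Cauchy-Schwarz inequality with weights [r ^ n], [e < r < 1], dominates the
    square of the sum by the measurable series [H], whose expectation is a
    geometric series of ratio [e / r]. *)
Lemma integral_perpetuity_lty (v : R -> R) (e : R) (f : seqspace R -> R)
    (h : seqspace R -> \bar R) :
  measurable_fun setT v -> (\int[L]_x (v x ^+ 2)%:E = e%:E)%E -> e < 1 ->
  measurable_fun setT h -> (forall z, ((f z ^+ 2)%:E <= h z)%E) ->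
  (\int[Q]_z h z < +oo)%E ->
  (\int[P]_w (limn [series f (drop_seq n (p w)) *
      \prod_(0 <= k < n) v (p w k)]_n ^+ 2)%:E < +oo)%E.
Proof.
move=> mv ve e1 mh fh hfin.
have h0 z : (0 <= h z)%E by apply: le_trans (fh z); rewrite lee_fin sqr_ge0.
have e0 : 0 <= e.
  by rewrite -lee_fin -ve integral_ge0// => x _; rewrite lee_fin sqr_ge0.
(* any ratio strictly between [e] and 1 *)
have [r [r0 r1 er]] : exists r : R, [/\ 0 < r, r < 1 & e < r].
  by exists ((1 + e) / 2); split; lra.
pose term n (z : seqspace R) :=
  ((r ^- n)%:E * ((\prod_(0 <= k < n) v (z k) ^+ 2)%:E * h (drop_seq n z)))%E.
pose H (z : seqspace R) := ((1 - r)^-1%:E * \sum_(n <oo) term n z)%E.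
have mv2 : measurable_fun setT (fun x => v x ^+ 2) by exact: measurable_funX.
have term0 n z : (0 <= term n z)%E.
  rewrite /term; apply: mule_ge0; first by rewrite lee_fin invr_ge0 exprn_ge0// ltW.
  by apply: mule_ge0 => //; rewrite lee_fin prodr_ge0// => k _; exact: sqr_ge0.
have mprod n : measurable_fun setT (fun z : seqspace R =>
    (\prod_(0 <= k < n) v (z k) ^+ 2)%:E * h (drop_seq n z))%E.
  apply: emeasurable_funM; first by apply/measurable_EFinP; exact: (measurable_prod_coord n mv2).
  exact: (measurableT_comp mh (measurable_drop_seq n)).
have mterm n : measurable_fun setT (term n).
  by apply: emeasurable_funM => //; exact: measurable_cst.
have mH : measurable_fun setT H.
  apply: emeasurable_funM; first exact: measurable_cst.
  by apply: ge0_emeasurable_sum.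
have H0 z : (0 <= H z)%E.
  apply: mule_ge0; first by rewrite lee_fin invr_ge0 subr_ge0 ltW.
  by apply: nneseries_ge0 => n _ _; exact: term0.
have dom w : ((limn [series f (drop_seq n (p w)) *
    \prod_(0 <= k < n) v (p w k)]_n ^+ 2)%:E <= H (p w))%E.
  pose x n := f (drop_seq n (p w)) * (\prod_(0 <= k < n) v (p w k)) / r ^+ n.
  have rn0 n : r ^+ n != 0 by rewrite expf_neq0// gt_eqF.
  rewrite (_ : (fun n => _ * _) = (fun n => r ^+ n * x n)); last first.
    by apply/funext => n; rewrite /x [RHS]mulrC divfK.
  apply: (@le_trans _ _ ((1 - r)^-1%:E * \sum_(n <oo) (r ^+ n * x n ^+ 2)%:E)%E).
    apply: sqr_limn_series_le => [i|n]; first by rewrite exprn_ge0// ltW.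
    by rewrite geometric_sum_le// ltW.
  rewrite lee_wpmul2l ?lee_fin ?invr_ge0 ?subr_ge0 ?(ltW r1)//.
  apply: lee_nneseries => n.
    by move=> _ _; rewrite lee_fin mulr_ge0 ?sqr_ge0 ?exprn_ge0// ltW.
  move=> _; rewrite /term.
  have -> : r ^+ n * x n ^+ 2 = r ^- n * ((\prod_(0 <= k < n) v (p w k) ^+ 2) *
     f (drop_seq n (p w)) ^+ 2).
    rewrite prodrXl /x; field. exact: rn0.
  rewrite EFinM lee_wpmul2l ?lee_fin ?invr_ge0 ?exprn_ge0 ?(ltW r0)//.
  rewrite EFinM lee_wpmul2l ?fh// lee_fin.
  by rewrite prodr_ge0// => k _; exact: sqr_ge0.
apply: (le_lt_trans (le_integral_pointwise P dom)).
rewrite -(ge0_integral_distribution p mH H0).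
rewrite /H ge0_integralZl//; last 3 first.
- exact: ge0_emeasurable_sum.
- by move=> z _; exact: nneseries_ge0.
- by rewrite lee_fin invr_ge0 subr_ge0 ltW.
rewrite integral_nneseries//.
have hfin' : (\int[Q]_z h z)%E \is a fin_num by rewrite ge0_fin_numE// integral_ge0.
have termE n : (\int[Q]_z term n z = (fine (\int[Q]_z h z))%:E * ((e / r) ^+ n)%:E)%E.
  rewrite /term ge0_integralZl//; last 2 first.
  - by move=> z _; rewrite mule_ge0// lee_fin prodr_ge0// => k _; exact: sqr_ge0.
  - by rewrite lee_fin invr_ge0 exprn_ge0// ltW.
  rewrite (integral_prod_drop LQ n mv2 (fun x => sqr_ge0 _) ve mh h0).
  rewrite -[in LHS](fineK hfin') -!EFinM; congr EFin; rewrite expr_div_n; ring.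
have er0 : 0 <= e / r by rewrite divr_ge0// ltW.
under eq_eseriesr => n _ do rewrite termE.
rewrite nneseriesZl; last by move=> n _; rewrite lee_fin exprn_ge0.
have geofin : (\sum_(n <oo) ((e / r) ^+ n)%:E)%E \is a fin_num.
  rewrite ge0_fin_numE; first by rewrite nneseries_geometric_lty// ltr_pdivrMr// mul1r.
  by apply: nneseries_ge0 => n _ _; rewrite lee_fin exprn_ge0.
by rewrite -(fineK geofin) -!EFinM ltry.
Qed.

End sufficiency.

(** * The coefficients of the EGARCH recursion *)

Section egarch_coefficients.
Variables (R : realType) (beta gamma delta : R).
Hypothesis gd : `|gamma| <= delta.

Definition innov (x : R) : R := gamma * x + delta * `|x|.

Definition vcoef (x : R) : R := beta - 2^-1 * innov x.

Lemma innov_ge0 x : 0 <= innov x.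
Proof.
have h : - (gamma * x) <= delta * `|x|.
  by apply: (le_trans (ler_norm _)); rewrite normrN normrM ler_wpM2r.
by rewrite /innov -lerBlDl sub0r.
Qed.

Lemma innov_le x : innov x <= 2 * delta * `|x|.
Proof.
have h : gamma * x <= delta * `|x|.
  by apply: (le_trans (ler_norm _)); rewrite normrM ler_wpM2r.
by rewrite /innov -mulrA [leRHS]mulr_natl mulr2n lerD2r.
Qed.

Lemma innov_sqr_le x : innov x ^+ 2 <= 4 * delta ^+ 2 * x ^+ 2.
Proof.
have d0 : 0 <= delta by apply: le_trans gd.
have -> : 4 * delta ^+ 2 * x ^+ 2 = (2 * delta * `|x|) ^+ 2.
  by rewrite !exprMn -normrX ger0_norm ?sqr_ge0//; ring.
by rewrite ler_sqr ?nnegrE ?innov_ge0 ?innov_le// !mulr_ge0.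
Qed.

Lemma measurable_innov : measurable_fun setT innov.
Proof.
apply: measurable_funD; apply: measurable_funM => //; exact: measurable_cst.
Qed.

Lemma measurable_vcoef : measurable_fun setT vcoef.
Proof.
apply: measurable_funB => //; apply: measurable_funM => //; exact: measurable_innov.
Qed.

End egarch_coefficients.

Section egarch_sufficiency.
Variables (d : measure_display) (T : measurableType d) (R : realType).
Variables (P : probability T R) (Z : int -> {RV P >-> R}).
Variables (alpha beta gamma delta : R) (t : int).
Hypothesis iidZ : iid Z.
Hypothesis Z2 : ('E_P[fun w => (Z 0 w ^+ 2)%R] = 1)%E.
Hypothesis (b0 : 0 <= beta) (b1 : beta < 1) (gd : `|gamma| <= delta).

Local Notation L := (distribution P (Z 0)).
Local Notation Q := (distribution P (past Z t)).

Lemma integral_law (phi : R -> R) : measurable_fun setT phi -> (forall x, 0 <= phi x) ->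
  (\int[L]_x (phi x)%:E = \int[P]_w (phi (Z 0 w))%:E)%E.
Proof.
move=> mphi phi0; rewrite ge0_integral_distribution//.
exact/measurable_EFinP.
Qed.

Lemma integral_law_sqr : (\int[L]_x (x ^+ 2)%:E = 1)%E.
Proof.
rewrite integral_law; first by rewrite -[RHS]Z2 unlock.
  exact: measurable_funX.
by move=> x; exact: sqr_ge0.
Qed.

Lemma integral_innov_sqr_lty : (\int[L]_x (innov gamma delta x ^+ 2)%:E < +oo)%E.
Proof.
apply: (@le_lt_trans _ _ (\int[L]_x ((4 * delta ^+ 2)%:E * (x ^+ 2)%:E))%E).
  by apply: le_integral_pointwise => x; rewrite -EFinM lee_fin innov_sqr_le.
rewrite ge0_integralZl//; last 3 first.
- exact/measurable_EFinP/measurable_funX.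
- by move=> x _; rewrite lee_fin sqr_ge0.
- by rewrite lee_fin mulr_ge0// sqr_ge0.
by rewrite integral_law_sqr mule1 ltry.
Qed.

Definition log_vol (z : seqspace R) : R :=
  alpha * (1 - beta)^-1 + limn [series beta ^+ n * innov gamma delta (z n.+1)]_n.

(** Seen from time [t], [log sigma^2] at time [t - n - 1] is a function of
    [Z_(t-n-2), Z_(t-n-3), ...]; this is why [log_vol] skips the coordinate 0
    of the dropped sequence. *)
Lemma log_sigma2_past (n : nat) w :
  log_sigma2 Z alpha beta gamma delta (t - n.+1%:Z) w = log_vol (drop_seq n (past Z t w)).
Proof.
rewrite /log_sigma2 /log_vol; congr (_ + limn (series _)).
apply/funext => k; rewrite /drop_seq /past /innov/=.
by have -> : t - n.+1%:Z - k.+1%:Z = t - (n + k.+1).+1%:Z by lia.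
Qed.

(** A measurable majorant of [log_vol ^ 2], from [(c + l)^2 <= 2 c^2 + 2 l^2]
    and the weighted Cauchy-Schwarz inequality with weights [beta ^ n]. *)
Definition log_vol_sqr_bound (z : seqspace R) : \bar R :=
  ((2 * (alpha * (1 - beta)^-1) ^+ 2)%:E + (2 * (1 - beta)^-1)%:E *
    \sum_(n <oo) (beta ^+ n * innov gamma delta (z n.+1) ^+ 2)%:E)%E.

Lemma log_vol_sqr_le z : ((log_vol z ^+ 2)%:E <= log_vol_sqr_bound z)%E.
Proof.
rewrite /log_vol /log_vol_sqr_bound.
have CS := @sqr_limn_series_le R (fun n => beta ^+ n) (fun n => innov gamma delta (z n.+1))
  (1 - beta)^-1 (fun i => exprn_ge0 i b0) (fun n => geometric_sum_le n b0 b1).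
move: (limn _) CS => l CS; set c := alpha * _.
apply: (@le_trans _ _ ((2 * c ^+ 2)%:E + 2%:E * (l ^+ 2)%:E)%E).
  rewrite -EFinM -EFinD lee_fin.
  have := sqr_ge0 (c - l); nra.
by rewrite (EFinM 2 (1 - beta)^-1) -muleA leeD2l// lee_wpmul2l// lee_fin.
Qed.

Lemma measurable_log_vol_sqr_bound : measurable_fun setT log_vol_sqr_bound.
Proof.
have mi := measurable_innov gamma delta.
apply: emeasurable_funD; first exact: measurable_cst.
apply: emeasurable_funM; first exact: measurable_cst.
apply: ge0_emeasurable_sum => [n z _ _|n _].
  by rewrite lee_fin mulr_ge0 ?sqr_ge0 ?exprn_ge0.
apply/measurable_EFinP; apply: measurable_funM => //; apply: measurable_funX.
exact: (measurableT_comp mi (measurable_coord n.+1)).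
Qed.

Lemma log_vol_sqr_bound_lty : (\int[Q]_z log_vol_sqr_bound z < +oo)%E.
Proof.
have LQ := iid_law_past t iidZ.
have mi := measurable_innov gamma delta.
have term0 n z : (0 <= (beta ^+ n * innov gamma delta (z n.+1) ^+ 2)%:E)%E.
  by rewrite lee_fin mulr_ge0 ?sqr_ge0 ?exprn_ge0.
have msq n : measurable_fun setT (fun z : seqspace R => (innov gamma delta (z n.+1) ^+ 2)%:E).
  apply/measurable_EFinP/measurable_funX.
  exact: (measurableT_comp mi (measurable_coord n.+1)).
have mterm n : measurable_fun setT
    (fun z : seqspace R => (beta ^+ n * innov gamma delta (z n.+1) ^+ 2)%:E).
  by apply/measurable_EFinP; apply: measurable_funM => //; apply/measurable_EFinP; exact: msq.
have K0 : 0 <= 2 * (1 - beta)^-1 by rewrite mulr_ge0// invr_ge0 subr_ge0 ltW.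
have sum0 z : (0 <= \sum_(n <oo) (beta ^+ n * innov gamma delta (z n.+1) ^+ 2)%:E)%E.
  by apply: nneseries_ge0 => n _ _; exact: term0.
have msum : measurable_fun setT (fun z : seqspace R =>
    \sum_(n <oo) (beta ^+ n * innov gamma delta (z n.+1) ^+ 2)%:E)%E.
  by apply: ge0_emeasurable_sum.
rewrite /log_vol_sqr_bound ge0_integralD//; last 3 first.
- by move=> z _; rewrite lee_fin mulr_ge0// sqr_ge0.
- by move=> z _; apply: mule_ge0; rewrite ?lee_fin.
- by apply: emeasurable_funM => //; exact: measurable_cst.
rewrite integral_cst_probability; apply: lte_add_pinfty; first exact: ltry.
rewrite ge0_integralZl ?lee_fin// integral_nneseries//.
have wfin : (\int[L]_x (innov gamma delta x ^+ 2)%:E)%E \is a fin_num.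
  rewrite ge0_fin_numE ?integral_innov_sqr_lty//.
  by apply: integral_ge0 => x _; rewrite lee_fin sqr_ge0.
have termE n : (\int[Q]_z (beta ^+ n * innov gamma delta (z n.+1) ^+ 2)%:E =
    (fine (\int[L]_x (innov gamma delta x ^+ 2)%:E))%:E * (beta ^+ n)%:E)%E.
  under eq_integral do rewrite EFinM.
  rewrite ge0_integralZl ?lee_fin ?exprn_ge0//; last by move=> z _; rewrite lee_fin sqr_ge0.
  rewrite (integral_coord LQ (phi := fun x => (innov gamma delta x ^+ 2)%:E)).
  - by rewrite fineK// muleC.
  - exact/measurable_EFinP/measurable_funX.
  - by move=> x; rewrite lee_fin sqr_ge0.
under eq_eseriesr => n _ do rewrite termE.
rewrite nneseriesZl; last by move=> n _; rewrite lee_fin exprn_ge0.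
have geofin : (\sum_(n <oo) (beta ^+ n)%:E)%E \is a fin_num.
  rewrite ge0_fin_numE; first by rewrite nneseries_geometric_lty.
  by apply: nneseries_ge0 => n _ _; rewrite lee_fin exprn_ge0.
by rewrite -(fineK geofin) -!EFinM ltry.
Qed.

Lemma B_diagE (i : 'I_4) : B_ Z alpha beta gamma delta t i i =
  (\int[P]_w (grad_g Z alpha beta gamma delta t w i ord0 ^+ 2)%:E)%E.
Proof.
rewrite /B_ mxE unlock; apply: eq_integral => w _.
by rewrite mxE big_ord1 [X in _ * X]mxE.
Qed.

Lemma prod_V_past (n : nat) w :
  \prod_(1 <= k < n.+1) V_ Z beta gamma delta (t - k%:Z) w =
  \prod_(0 <= k < n) vcoef beta gamma delta (past Z t w k).
Proof. by rewrite big_add1. Qed.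

(** Each coordinate of [U] is dominated in square by an integrable function of
    the sequence, so [integral_perpetuity_lty] applies to all four entries. *)
Lemma B_diag_lty (i : 'I_4) :
  ('E_P[fun w => (V_ Z beta gamma delta 0 w ^+ 2)%R] < 1)%E ->
  (B_ Z alpha beta gamma delta t i i < +oo)%E.
Proof.
move=> V1.
have LQ := iid_law_past t iidZ.
have mv := measurable_vcoef beta gamma delta.
have vV : (\int[L]_x (vcoef beta gamma delta x ^+ 2)%:E =
    'E_P[fun w => (V_ Z beta gamma delta 0 w ^+ 2)%R])%E.
  rewrite unlock integral_law//; first exact: measurable_funX.
  by move=> x; exact: sqr_ge0.
have efin : (\int[L]_x (vcoef beta gamma delta x ^+ 2)%:E)%E \is a fin_num.
  rewrite ge0_fin_numE ?vV ?(lt_trans V1) ?ltry//.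
  by rewrite -vV integral_ge0// => x _; rewrite lee_fin sqr_ge0.
pose e := fine (\int[L]_x (vcoef beta gamma delta x ^+ 2)%:E)%E.
have ve : (\int[L]_x (vcoef beta gamma delta x ^+ 2)%:E = e%:E)%E by rewrite /e fineK.
have e1 : e < 1 by rewrite -lte_fin -ve vV.
suff [f [h [mh fh hfin fU]]] : exists (f : seqspace R -> R) (h : seqspace R -> \bar R),
  [/\ measurable_fun setT h, forall z, ((f z ^+ 2)%:E <= h z)%E, (\int[Q]_z h z < +oo)%E &
   forall n w, U_ Z alpha beta gamma delta (t - n.+1%:Z) w i 0 = f (drop_seq n (past Z t w))].
  rewrite B_diagE.
  have := integral_perpetuity_lty LQ mv ve e1 mh fh hfin.
  congr (_ < _)%E; apply: eq_integral => w _; congr ((_ ^+ 2)%:E).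
  rewrite mxE; congr (limn (series _)); apply/funext => n.
  by rewrite /= fU prod_V_past.
have msq : measurable_fun setT (fun z : seqspace R => (z 0%N ^+ 2)%:E).
  apply/measurable_EFinP/measurable_funX; exact: measurable_coord.
have sqQ : (\int[Q]_z (z 0%N ^+ 2)%:E < +oo)%E.
  rewrite (integral_coord LQ (phi := fun x => (x ^+ 2)%:E)).
  - by rewrite integral_law_sqr ltry.
  - exact/measurable_EFinP/measurable_funX.
  - by move=> x; rewrite lee_fin sqr_ge0.
case: i => -[|[|[|[|//]]]] i4.
- exists (fun=> 1), (fun=> 1%E); split => //.
  + by move=> z; rewrite expr1n.
  + by rewrite integral_cst_probability ltry.
  + by move=> n w; rewrite mxE.
- exists log_vol, log_vol_sqr_bound; split => //.
  + exact: measurable_log_vol_sqr_bound.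
  + exact: log_vol_sqr_le.
  + exact: log_vol_sqr_bound_lty.
  + by move=> n w; rewrite mxE/= log_sigma2_past.
- exists (fun z => z 0%N), (fun z => (z 0%N ^+ 2)%:E); split => //.
  by move=> n w; rewrite mxE/= /drop_seq addn0.
- exists (fun z => `|z 0%N|), (fun z => (z 0%N ^+ 2)%:E); split => //.
  + by move=> z; rewrite -normrX ger0_norm ?sqr_ge0.
  + by move=> n w; rewrite mxE/= /drop_seq addn0.
Qed.

End egarch_sufficiency.

(** * The perpetuity of iid coefficients *)

Section perpetuity.
Variables (R : realType) (L : probability R R) (Q : probability (seqspace R) R).
Hypothesis LQ : iid_law L Q.
Variable v : R -> R.
Hypothesis mv : measurable_fun setT v.

Definition vprod (n : nat) (z : seqspace R) : R := \prod_(0 <= k < n) v (z k).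

Definition abs_sum (z : seqspace R) : \bar R := (\sum_(n <oo) (`|vprod n z|%R)%:E)%E.

(** Setting the value to 0 off the set of absolute convergence makes this a
    pointwise limit of measurable functions, hence measurable. *)
Definition perpetuity (z : seqspace R) : R :=
  if (abs_sum z < +oo)%E then limn [series vprod n z]_n else 0.

Lemma measurable_vprod n : measurable_fun setT (vprod n).
Proof. exact: (measurable_prod_coord n mv). Qed.

Lemma measurable_abs_sum : measurable_fun setT abs_sum.
Proof.
apply: ge0_emeasurable_sum => [n z _ _|n _]; first by rewrite lee_fin.
by apply/measurable_EFinP; apply: measurableT_comp => //; exact: measurable_vprod.
Qed.

Lemma measurable_perpetuity : measurable_fun setT perpetuity.
Proof.
have mC : measurable [set z | (abs_sum z < +oo)%E].
  rewrite -[X in measurable X]setTI.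
  exact: (emeasurable_fun_infty_o measurableT measurable_abs_sum).
apply: (@measurable_fun_cvg _ _ _ _
  (fun n z => series (vprod^~ z) n * \1_[set z | (abs_sum z < +oo)%E] z)).
  move=> n; apply: measurable_funM; last exact: measurable_indic.
  by rewrite /series/=; apply: measurable_sum => k; exact: measurable_vprod.
move=> z _; rewrite /perpetuity; case: ifPn => zC.
  rewrite -[X in _ --> X]mulr1 indicE mem_set//; apply: cvgM; last exact: cvg_cst.
  exact: nneseries_lty_cvg_series.
rewrite indicE memNset; last exact/negP.
under eq_fun do rewrite mulr0.
exact: cvg_cst.
Qed.

Lemma vprodS n z : vprod n.+1 z = v (z 0%N) * vprod n (shift_seq z).
Proof. by rewrite /vprod big_nat_recl. Qed.

Lemma vprod0 z : vprod 0 z = 1.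
Proof. by rewrite /vprod big_geq. Qed.

(** Absolute convergence at [z] passes to the shifted sequence unless
    [v (z 0) = 0]; in that case every product but the empty one vanishes and
    the identity reads [1 = 1], whatever happens at the shifted sequence. *)
Lemma perpetuity_rec z : (abs_sum z < +oo)%E ->
  perpetuity z = 1 + v (z 0%N) * perpetuity (shift_seq z).
Proof.
move=> zfin; rewrite {1}/perpetuity zfin.
have seriesE n : series (vprod^~ z) n.+1 =
    1 + v (z 0%N) * series (vprod^~ (shift_seq z)) n.
  rewrite /series/= big_nat_recl// vprod0 big_distrr/=; congr (_ + _).
  by apply: eq_bigr => k _; rewrite vprodS.
apply/cvg_lim => //; rewrite -(cvg_shiftS (series _)).
rewrite (_ : (fun n => _) = 
    (fun n => 1 + v (z 0%N) * series (vprod^~ (shift_seq z)) n)); last first.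
  by apply/funext => n; exact: seriesE.
(* without a zero factor, the shifted series converges absolutely *)
have [->|v0] := eqVneq (v (z 0%N)) 0.
  by under eq_fun do rewrite mul0r; rewrite mul0r; exact: cvg_cst.
apply: cvgD; first exact: cvg_cst.
apply: cvgM; first exact: cvg_cst.
have sfin : (abs_sum (shift_seq z) < +oo)%E.
  have v0' : 0 < `|v (z 0%N)| by rewrite normr_gt0.
  have t0 n y : (0 <= (`|vprod n y|%R)%:E)%E by rewrite lee_fin.
  have Sfin : abs_sum z \is a fin_num by rewrite ge0_fin_numE// nneseries_ge0.
  apply: (@le_lt_trans _ _ (fine (abs_sum z) / `|v (z 0%N)|)%:E); last exact: ltry.
  apply: lime_le; first by apply: is_cvg_nneseries => n _ _; exact: t0.
  apply: nearW => N; rewrite sumEFin lee_fin ler_pdivlMr//.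
  rewrite -lee_fin fineK//.
  apply: (@le_trans _ _ (\sum_(0 <= n < N.+1) (`|vprod n z|%R)%:E)%E); last exact: nneseries_lim_ge.
  rewrite sumEFin lee_fin big_nat_recl//= mulrC big_distrr/=.
  rewrite (eq_bigr (fun n => `|vprod n.+1 z|)); first by rewrite lerDr.
  by move=> n _; rewrite vprodS normrM.
rewrite /perpetuity sfin; exact: nneseries_lty_cvg_series.
Qed.

(** The root of order [m + 1] is multiplicative, so the roots of the products
    have expectations [rho ^ n] with [rho < 1]; their sum is integrable, thus
    almost surely finite, and raising back to the power [m + 1] keeps it so. *)
Lemma abs_sum_lty_ae (m : nat) :
  (\int[L]_x (`|v x| `^ m.+1%:R^-1)%:E < 1)%E ->
  {ae Q, forall z, (abs_sum z < +oo)%E}.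
Proof.
move=> root1.
pose phi x := `|v x| `^ m.+1%:R^-1.
have phi0 x : 0 <= phi x by exact: powR_ge0.
have mphi : measurable_fun setT phi.
  by apply: (measurableT_comp (measurable_powR _)); exact: measurableT_comp.
have rho0 : (0 <= \int[L]_x (phi x)%:E)%E by apply: integral_ge0 => x _; rewrite lee_fin.
have rhofin : (\int[L]_x (phi x)%:E)%E \is a fin_num.
  by rewrite ge0_fin_numE// (lt_trans root1)// ltry.
pose rho := fine (\int[L]_x (phi x)%:E)%E.
have rhoE : (\int[L]_x (phi x)%:E = rho%:E)%E by rewrite /rho fineK.
have rho1 : rho < 1 by rewrite -lte_fin -rhoE.
have rho0' : 0 <= rho by rewrite -lee_fin -rhoE.
pose b n (z : seqspace R) := \prod_(0 <= k < n) phi (z k).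
have b0 n z : 0 <= b n z by exact: prodr_ge0.
have bE n z : b n z ^+ m.+1 = `|vprod n z|.
  rewrite /b /vprod -prodrXl normr_prod; apply: eq_bigr => k _.
  by rewrite /phi -powR_mulrn ?powR_ge0// -powRrM mulVf ?pnatr_eq0// powRr1.
have mb n : measurable_fun setT (b n) by exact: (measurable_prod_coord n mphi).
have intb n : (\int[Q]_z (b n z)%:E = (rho ^+ n)%:E)%E.
  have := integral_prod_drop LQ n mphi phi0 rhoE (h := fun=> 1%E).
  rewrite integral_cst_probability mule1 => <-//.
  by apply: eq_integral => z _; rewrite mule1.
have isum : Q.-integrable setT (fun z => \sum_(n <oo) (b n z)%:E)%E.
  apply/integrableP; split.
    apply: ge0_emeasurable_sum => [n z _ _|n _]; first by rewrite lee_fin.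
    exact/measurable_EFinP.
  rewrite (eq_integral (fun z => \sum_(n <oo) (b n z)%:E)%E); last first.
    by move=> z _; rewrite gee0_abs//; apply: nneseries_ge0 => n _ _; rewrite lee_fin.
  rewrite integral_nneseries//; last 2 first.
  - by move=> n; exact/measurable_EFinP.
  - by move=> n z _; rewrite lee_fin.
  under eq_eseriesr => n _ do rewrite intb.
  exact: nneseries_geometric_lty.
have := integrable_ae measurableT isum.
apply: filterS => z /(_ I) fin.
have fin' : (\sum_(n <oo) (b n z)%:E < +oo)%E by rewrite ltey_eq fin.
rewrite /abs_sum; under eq_eseriesr => n _ do rewrite -bE.
exact: nneseries_exprS_lty.
Qed.


(** The perpetuity [G] solves [G = 1 + V G'], with [G']
    independent of [V] and distributed as [G]. Comparing first and second moments gives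
    [Var G * (1 - E V^2) = (E G)^2 * Var V], which is incompatible with
    [E V^2 >= 1] unless [V] is constant; a constant with a root of expectation
    less than 1 is less than 1 in absolute value. *)
Lemma second_moment_lt1_of_perpetuity (m : nat) :
  (\int[L]_x (`|v x| `^ m.+1%:R^-1)%:E < 1)%E ->
  (\int[L]_x (v x ^+ 2)%:E < +oo)%E ->
  (\int[L]_x (v x)%:E < 1)%E ->
  (\int[Q]_z (perpetuity z ^+ 2)%:E < +oo)%E ->
  (\int[L]_x (v x ^+ 2)%:E < 1)%E.
Proof.
move=> root1 v2fin v1 p2fin.
have mp := measurable_perpetuity.
have [iv iv2] := integrable_sqr mv v2fin.
have [ip ip2] := integrable_sqr mp p2fin.
have fin_real d' (T' : measurableType d') (mu : probability T' R) (f : T' -> R) :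
    mu.-integrable setT (fun x => (f x)%:E) -> exists r : R, (\int[mu]_x (f x)%:E = r%:E)%E.
  by move=> /(integrable_fin_num measurableT) /fineK <-; eexists.
have [ev evE] := fin_real _ _ _ _ iv.
have [e2 e2E] := fin_real _ _ _ _ iv2.
have [mu muE] := fin_real _ _ _ _ ip.
have [m2 m2E] := fin_real _ _ _ _ ip2.
pose g (z : seqspace R) := v (z 0%N) * perpetuity (shift_seq z).
have mg : measurable_fun setT g.
  apply: measurable_funM; first exact: (measurableT_comp mv (measurable_coord 0%N)).
  exact: (measurableT_comp mp (@measurable_shift_seq R)).
have g2E : (\int[Q]_z (g z ^+ 2)%:E = (e2 * m2)%:E)%E.
  rewrite EFinM -e2E -m2E -(ge0_integral_head_shift LQ
    (phi := fun x => (v x ^+ 2)%:E) (h := fun z => (perpetuity z ^+ 2)%:E)).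
  - by apply: eq_integral => z _; rewrite /g exprMn EFinM.
  - exact/measurable_EFinP/measurable_funX.
  - by move=> x; rewrite lee_fin sqr_ge0.
  - exact/measurable_EFinP/measurable_funX.
  - by move=> x; rewrite lee_fin sqr_ge0.
have g2fin : (\int[Q]_z (g z ^+ 2)%:E < +oo)%E by rewrite g2E ltry.
have [ig ig2] := integrable_sqr mg g2fin.
have gE : (\int[Q]_z (g z)%:E = (ev * mu)%:E)%E.
  by rewrite EFinM -evE -muE -(integral_head_shift LQ iv ip).
have pg : {ae Q, forall z, perpetuity z = 1 + g z}.
  by apply: filterS (abs_sum_lty_ae root1) => z; exact: perpetuity_rec.
have mu_rec : mu = 1 + ev * mu.
  apply: EFin_inj; rewrite -muE.
  have -> : 1 + ev * mu = 1 + 1 * (ev * mu) + 0 * (e2 * m2) by rewrite mul1r mul0r addr0.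
  rewrite -(integral_quadratic 1 1 0 ig ig2 gE g2E).
  apply: ae_eq_integral => //.
  - exact/measurable_EFinP.
  - exact: measurable_quadratic.
  - by apply: filterS pg => z -> _; rewrite mul1r mul0r addr0.
have m2_rec : m2 = 1 + 2 * (ev * mu) + e2 * m2.
  apply: EFin_inj; rewrite -m2E.
  rewrite -[e2 * m2]mul1r -(integral_quadratic 1 2 1 ig ig2 gE g2E).
  apply: ae_eq_integral => //.
  - exact/measurable_EFinP/measurable_funX.
  - exact: measurable_quadratic.
  - by apply: filterS pg => z -> _; congr EFin; ring.
have jensen : mu ^+ 2 <= m2.
  have := integral_quadratic (mu ^+ 2) (- (2 * mu)) 1 ip ip2 muE m2E.
  have : (0 <= \int[Q]_z (mu ^+ 2 + - (2 * mu) * perpetuity z + 1 * perpetuity z ^+ 2)%:E)%E.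
    by apply: integral_ge0 => z _; rewrite lee_fin; have := sqr_ge0 (mu - perpetuity z); nra.
  by move=> + E; rewrite E lee_fin; nra.
have varE := integral_quadratic (ev ^+ 2) (- (2 * ev)) 1 iv iv2 evE e2E.
have var0 x : 0 <= ev ^+ 2 + - (2 * ev) * v x + 1 * v x ^+ 2.
  by have := sqr_ge0 (ev - v x); nra.
have var_ge0 : ev ^+ 2 <= e2.
  have : (0 <= \int[L]_x (ev ^+ 2 + - (2 * ev) * v x + 1 * v x ^+ 2)%:E)%E.
    by apply: integral_ge0 => x _; rewrite lee_fin.
  by rewrite varE lee_fin; nra.
have ev1 : ev < 1 by rewrite -lte_fin -evE.
rewrite e2E lte_fin ltNge; apply/negP => e2_ge1.
have mu0 : 0 < mu ^+ 2.
  rewrite lt_neqAle sqr_ge0 andbT eq_sym sqrf_eq0; apply/eqP => mu0.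
  by move: mu_rec; rewrite mu0; lra.
have identity : (m2 - mu ^+ 2) * (1 - e2) = mu ^+ 2 * (e2 - ev ^+ 2).
  (* squaring [mu = 1 + ev * mu] turns [1 + 2 ev mu] into [mu^2 (1 - ev^2)] *)
  have mu_sqr : (1 + ev * mu) ^+ 2 = mu ^+ 2 by rewrite -mu_rec.
  nra.
have e2E' : e2 = ev ^+ 2.
  apply/eqP; rewrite eq_le var_ge0 andbT -subr_le0 -(pmulr_rle0 _ mu0) -identity.
  by rewrite mulr_ge0_le0 ?subr_ge0// subr_le0.
have v_const : ae_eq L setT (fun x => (`|v x| `^ m.+1%:R^-1)%:E) (fun=> (`|ev| `^ m.+1%:R^-1)%:E).
  have : (\int[L]_x `|(ev ^+ 2 + - (2 * ev) * v x + 1 * v x ^+ 2)%:E| = 0)%E.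
    under eq_integral do rewrite gee0_abs ?lee_fin//.
    by rewrite varE e2E'; congr EFin; ring.
  move=> /(ae_eq_integral_abs L measurableT (measurable_quadratic _ _ _ mv)).
  apply: filterS => x /(_ I) [] qx0 _.
  have : (ev - v x) ^+ 2 = 0 by rewrite -[RHS]qx0; ring.
  by move=> /eqP; rewrite sqrf_eq0 subr_eq0 => /eqP <-.
have : (`|ev| `^ m.+1%:R^-1)%:E = (\int[L]_x (`|v x| `^ m.+1%:R^-1)%:E)%E.
  rewrite -[LHS](integral_cst_probability L); apply: ae_eq_integral => //.
    by apply/measurable_EFinP; apply: (measurableT_comp (measurable_powR _)); exact: measurableT_comp.
  by apply: filterS v_const => x h xT; rewrite h.
move=> ev_root; move: root1; rewrite -ev_root lte_fin ltNge => /negP; apply.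
have one_root : 1 `^ m.+1%:R^-1 = 1 :> R by rewrite powR1.
rewrite -[leLHS]one_root; apply: ge0_ler_powR; rewrite ?nnegrE//.
by rewrite -(ler_pXn2r (ltn0Sn 1)) ?nnegrE// expr1n -normrX ger0_norm ?sqr_ge0// -e2E'.
Qed.

End perpetuity.

(** * From invertibility to a fractional moment below one *)

Lemma sqrt_expR (R : realType) (x : R) : Num.sqrt (expR x) = expR (2^-1 * x).
Proof.
have -> : expR x = expR (2^-1 * x) ^+ 2 by rewrite -expRM_natl mulrA divff// mul1r.
by rewrite sqrtr_sqr ger0_norm ?expR_ge0.
Qed.

Section egarch_necessity.
Variables (d : measure_display) (T : measurableType d) (R : realType).
Variables (P : probability T R) (Z : int -> {RV P >-> R}).
Variables (alpha beta gamma delta : R) (t : int).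
Hypothesis iidZ : iid Z.
Hypothesis Z2 : ('E_P[fun w => (Z 0 w ^+ 2)%R] = 1)%E.
Hypothesis (b0 : 0 <= beta) (b1 : beta < 1) (gd : `|gamma| <= delta).

Local Notation L := (distribution P (Z 0)).
Local Notation Q := (distribution P (past Z t)).
Local Notation v := (vcoef beta gamma delta).

Lemma integral_vcoef_sqr_lty : (\int[L]_x (v x ^+ 2)%:E < +oo)%E.
Proof.
apply: (@le_lt_trans _ _ (\int[L]_x ((2 * beta ^+ 2)%:E + (innov gamma delta x ^+ 2)%:E))%E).
  apply: le_integral_pointwise => x; rewrite -EFinD lee_fin /vcoef.
  by move: (innov _ _ _) => y; have := sqr_ge0 (beta + 2^-1 * y); have := sqr_ge0 y; nra.
rewrite ge0_integralD//; last 3 first.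
- by move=> x _; rewrite lee_fin mulr_ge0// sqr_ge0.
- by move=> x _; rewrite lee_fin sqr_ge0.
- by apply/measurable_EFinP; apply: measurable_funX; exact: measurable_innov.
rewrite integral_cst_probability; apply: lte_add_pinfty; first exact: ltry.
exact: integral_innov_sqr_lty.
Qed.

Lemma integral_vcoef_lt1 : (\int[L]_x (v x)%:E < 1)%E.
Proof.
apply: (@le_lt_trans _ _ (\int[L]_x beta%:E)%E); last first.
  by rewrite integral_cst_probability lte_fin.
apply: le_integral_pointwise => x; rewrite lee_fin /vcoef gerBl.
by rewrite mulr_ge0// innov_ge0.
Qed.

(** The stationary log-volatility is [alpha / (1 - beta)] plus a series of
    nonnegative terms. Where that series diverges the limit operator yields 0,
    so the bound holds at every point of the sample space. *)
Lemma innov_le_rescaled_X w : innov gamma delta (Z 0 w) <=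
  (gamma * X_ Z alpha beta gamma delta 0 w + delta * `|X_ Z alpha beta gamma delta 0 w|)
    * expR (- (2^-1 * alpha / (1 - beta))).
Proof.
rewrite /X_ /sigma2 sqrt_expR /log_sigma2.
set S := limn _.
have S0 : 0 <= S.
  apply: limn_series_ge0 => n; rewrite mulr_ge0 ?exprn_ge0//.
  exact: (innov_ge0 gd).
rewrite normrM (ger0_norm (expR_ge0 _)).
rewrite [leRHS](_ : _ = expR (2^-1 * S) * innov gamma delta (Z 0 w)).
  rewrite -[leLHS]mul1r ler_wpM2r ?innov_ge0//.
  by rewrite -expR0 ler_expR mulr_ge0.
have -> : expR (2^-1 * S) = expR (2^-1 * (alpha * (1 - beta)^-1 + S)) *
    expR (- (2^-1 * alpha / (1 - beta))).
  by rewrite -expRD; congr expR; ring.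
by rewrite /innov; ring.
Qed.

(** [Y = max (beta, - V)] is at most the argument of the logarithm in the
    invertibility condition, and at least [|V|] because [V <= beta]. *)
Lemma exists_vcoef_root_lt1 : invertible Z alpha beta gamma delta ->
  exists m : nat, (\int[L]_x (`|v x| `^ m.+1%:R^-1)%:E < 1)%E.
Proof.
move=> inv.
pose Y x := Num.max beta (- v x).
have Y0 x : 0 <= Y x by rewrite /Y le_max b0.
have mv := measurable_vcoef beta gamma delta.
have mY : measurable_fun setT Y.
  apply: measurable_maxr; first exact: measurable_cst.
  exact: measurableT_comp.
have vY x : `|v x| <= Y x.
  rewrite /Y ler_norml lerNl !le_max lexx orbT/=.
  by rewrite /vcoef gerBl mulr_ge0// innov_ge0.
have mYZ : measurable_fun setT (Y \o Z 0) by exact: measurableT_comp.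
have YZ2 : (\int[P]_w (Y (Z 0 w) ^+ 2)%:E < +oo)%E.
  rewrite -(integral_law Z (phi := fun x => Y x ^+ 2)); last 2 first.
  - exact: measurable_funX.
  - by move=> x; exact: sqr_ge0.
  apply: (@le_lt_trans _ _ (\int[L]_x ((beta ^+ 2)%:E + (v x ^+ 2)%:E))%E).
    apply: le_integral_pointwise => x; rewrite -EFinD lee_fin /Y.
    by case: (leP beta (- v x)) => _; rewrite ?sqrrN ?lerDl ?lerDr sqr_ge0.
  rewrite ge0_integralD//; last 3 first.
  - by move=> x _; rewrite lee_fin sqr_ge0.
  - by move=> x _; rewrite lee_fin sqr_ge0.
  - by apply/measurable_EFinP; exact: measurable_funX.
  rewrite integral_cst_probability; apply: lte_add_pinfty; first exact: ltry.
  exact: integral_vcoef_sqr_lty.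
have [iY _] := integrable_sqr mYZ YZ2.
have [|m rootY] := exists_root_expectation_lt1 mYZ (fun w => Y0 (Z 0 w)) iY.
  apply: le_lt_trans inv; apply: le_integral_pointwise => w.
  rewrite lee_lne; last 2 first.
  - by rewrite in_itv/= leey lee_fin Y0.
  - by rewrite in_itv/= leey lee_fin le_max b0.
  rewrite lee_fin ge_max !le_max lexx/=; apply/orP; right.
  by rewrite /vcoef opprB lerD2r -mulrA ler_wpM2l// innov_le_rescaled_X.
exists m; rewrite integral_law.
- apply: le_lt_trans rootY; apply: le_integral_pointwise => w; rewrite lee_fin.
  by apply: ge0_ler_powR; rewrite ?nnegrE// Y0.
- by apply: (measurableT_comp (measurable_powR _)); exact: measurableT_comp.
- by move=> x; exact: powR_ge0.
Qed.

(** The first entry of the gradient is the perpetuity wherever the latter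
    converges absolutely, and elsewhere the perpetuity is 0; so [B_11] bounds
    its second moment. *)
Lemma V_second_moment_lt1 :
  invertible Z alpha beta gamma delta ->
  (B_ Z alpha beta gamma delta t ord0 ord0 < +oo)%E ->
  ('E_P[fun w => (V_ Z beta gamma delta 0 w ^+ 2)%R] < 1)%E.
Proof.
move=> inv B0.
have LQ := iid_law_past t iidZ.
have mv := measurable_vcoef beta gamma delta.
have [m root1] := exists_vcoef_root_lt1 inv.
have mp := measurable_perpetuity mv.
have := second_moment_lt1_of_perpetuity LQ mv root1 integral_vcoef_sqr_lty integral_vcoef_lt1.
rewrite integral_law; last 2 first.
- exact: measurable_funX.
- by move=> x; exact: sqr_ge0.
rewrite unlock; apply.
rewrite ge0_integral_distribution; last 2 first.
- exact/measurable_EFinP/measurable_funX.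
- by move=> x; rewrite lee_fin sqr_ge0.
apply: le_lt_trans B0; rewrite B_diagE; apply: le_integral_pointwise => w.
rewrite /= lee_fin mxE /perpetuity; case: ifPn => _; last by rewrite expr0n sqr_ge0.
set l := limn _; set l' := limn _.
have -> // : l = l'.
rewrite /l /l'; congr (limn (series _)); apply/funext => n.
by rewrite /= mxE/= mul1r prod_V_past.
Qed.

End egarch_necessity.

Theorem lemma1 (d : measure_display) (T : measurableType d) (R : realType)
    (P : probability T R) (Z : int -> {RV P >-> R})
    (alpha0 beta0 gamma0 delta0 : R) (t : int) :
  iid Z ->
  ~ two_point (Z 0) ->
  ('E_P[fun w => (Z 0 w ^+ 2)%R] = 1)%E ->
  `|beta0| < 1 ->
  0 <= beta0 ->
  `|gamma0| <= delta0 ->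
  invertible Z alpha0 beta0 gamma0 delta0 ->
  (\sum_(i < 4) B_ Z alpha0 beta0 gamma0 delta0 t i i < +oo)%E <->
  ('E_P[fun w => (V_ Z beta0 gamma0 delta0 0 w ^+ 2)%R] < 1)%E.
Proof.
move=> iidZ _ Z2 beta_lt1 b0 gd inv.
have b1 : beta0 < 1 by move: beta_lt1; rewrite ger0_norm.
split=> [sumB|V1]; last first.
  by apply: lte_sum_pinfty => i _; exact: B_diag_lty.
apply: (V_second_moment_lt1 (t := t) iidZ Z2 b0 b1 gd inv).
apply: le_lt_trans sumB; rewrite big_ord_recl leeDl//.
apply: sume_ge0 => i _; rewrite B_diagE; apply: integral_ge0 => w _.
by rewrite lee_fin sqr_ge0.
Qed.
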